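(* No random online function $F:2^\omega\to 2^\omega$ is onto; that is, for every random online function $F$, $\mathrm{ran}(F)\neq 2^\omega$.
   Context: $2^{<\omega}$ is the set of finite binary strings, $\epsilon$ the empty string, and $y\upharpoonright n=(y(0),\dots,y(n-1))$. Let $\sigma_0=\epsilon,\sigma_1,\sigma_2,\dots$ list $2^{<\omega}$ in length-lexicographic order. Each $x\in 2^\omega$ codes the representing function $f_x:2^{<\omega}\setminus\{\epsilon\}\to\{0,1\}$ given by $f_x(\sigma_{n+1})=x(n)$ for all $n$, and the online function $F_x:2^\omega\to 2^\omega$ given by $F_x(y)=f_x(y\upharpoonright 1)\,f_x(y\upharpoonright 2)\,f_x(y\upharpoonright 3)\cdots$, i.e. $F_x(y)(n)=f_x(y\upharpoonright (n+1))$. A function $F$ is a random online function if $F=F_x$ for some $x\in 2^\omega$ that is Martin-Löf random with respect to the uniform measure on $2^\omega$. *)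

(* Defs.v *)
From HB Require Import structures.
From mathcomp Require Import all_boot all_order all_algebra zify.
From mathcomp Require Import all_classical all_reals all_analysis.

Set Implicit Arguments.
Unset Strict Implicit.
Unset Printing Implicit Defensive.

Import Order.TTheory GRing.Theory Num.Theory.
Import numFieldNormedType.Exports.

Local Open Scope classical_set_scope.
Local Open Scope ring_scope.

Definition restr (y : cantor_space) (n : nat) : seq bool := mkseq y n.

Definition cylinder (s : seq bool) : set cantor_space :=
  [set y | restr y (size s) = s].

Definition open_of (A : set (seq bool)) : set cantor_space :=
  \bigcup_(s in A) cylinder s.

(* The position of s in the length-lexicographic list of all binary strings:
   string_index s + 1 is the number with binary expansion 1s. *)
Definition string_index (s : seq bool) : nat :=
  foldl (fun k (b : bool) => (k.*2 + b.+1)%N) 0%N s.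

Definition length_lex (s t : seq bool) : bool :=
  (size s < size t)%N || (size s == size t) && ((s : seqlexi bool) < t)%O.

Lemma string_index_rcons s b :
  string_index (rcons s b) = ((string_index s).*2 + b.+1)%N.
Proof. by rewrite /string_index foldl_rcons. Qed.

Lemma string_index_bounds s :
  (2 ^ size s <= (string_index s).+1 < 2 ^ (size s).+1)%N.
Proof.
elim/last_ind: s => [//|s b IH]; rewrite string_index_rcons size_rcons !expnS.
by move: IH; rewrite expnS; case: b => /=; lia.
Qed.

Lemma string_index_cons b s :
  string_index (b :: s) = (b.+1 * 2 ^ size s + string_index s)%N.
Proof.
elim/last_ind: s => [|s c IH]; first by rewrite muln1 /string_index /= addn0.
rewrite -rcons_cons !string_index_rcons IH size_rcons expnS.
by case: b c {IH} => [] []; lia.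
Qed.

Lemma string_index_bij : bijective string_index.
Proof.
have inj : injective string_index.
  elim/last_ind => [|s b IH] t; case/lastP: t => [|t c] //;
    rewrite ?string_index_rcons ?[string_index [::]]/=.
  - by rewrite /string_index /=; case: c; lia.
  - by rewrite /string_index /=; case: b; lia.
  - move=> e; have [-> e'] : b = c /\ string_index s = string_index t.
      by move: e; case: b c => [] []; lia.
    by rewrite (IH _ e').
have surj n : exists s, string_index s = n.
  have [m] := ubnP n; elim: m n => [//|m IH] [|n]; first by exists [::].
  move=> lt_nm; have [|s Hs] := IH n./2; first by lia.
  exists (rcons s (odd n)); rewrite string_index_rcons Hs.
  by have := odd_double_half n; lia.
have [g gK] := choice surj.
by exists g => [s|//]; apply: inj.
Qed.

Lemma string_index_ltn s t :
  length_lex s t = (string_index s < string_index t)%N.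
Proof.
rewrite /length_lex.
have /andP[s1 s2] := string_index_bounds s.
have /andP[t1 t2] := string_index_bounds t.
have [lt_st|lt_ts|eq_st] /= := ltngtP (size s) (size t).
- have : (2 ^ (size s).+1 <= 2 ^ size t)%N by rewrite leq_exp2l.
  by lia.
- have : (2 ^ (size t).+1 <= 2 ^ size s)%N by rewrite leq_exp2l.
  by lia.
- elim: s t eq_st {s1 s2 t1 t2} => [|b s IH] [|c t] //= [eq_st].
  rewrite ltxi_cons IH // !string_index_cons eq_st.
  have := string_index_bounds s; have := string_index_bounds t.
  rewrite eq_st !expnS.
  by case: b c => [] [] /=; lia.
Qed.

Definition cantor_measurableType := g_sigma_algebraType (range cylinder).

Definition binary_digits (R : realType) (r : R) : cantor_measurableType :=
  fun n => odd (Num.truncn (r * 2 ^+ n.+1)).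

Lemma truncn_odd_half (R : realType) (r : R) : 0 <= r ->
  Num.truncn (r * 2) = (odd (Num.truncn (r * 2)) + (Num.truncn r).*2)%N.
Proof.
move=> r0; rewrite -{1}[LHS]odd_double_half; congr (_ + _.*2)%N.
apply/esym/eqP; rewrite truncn_eq //.
have /truncn_itv : 0 <= r * 2 by rewrite mulr_ge0.
have := odd_double_half (Num.truncn (r * 2)).
move: (Num.truncn (r * 2)) => m em /andP[m1 m2].
rewrite -(ler_pM2r (x := 2)) ?ltr0n // -(ltr_pM2r (x := 2)) ?ltr0n //.
rewrite -!natrM; apply/andP; split.
  by apply: le_trans m1; rewrite ler_nat; lia.
by apply: lt_le_trans m2 _; rewrite ler_nat; lia.
Qed.

Lemma cylinder_digitsP (R : realType) (r : R) (s : seq bool) : 0 <= r < 1 ->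
  cylinder s (binary_digits r) <->
  ((string_index s).+1 = Num.truncn (r * 2 ^+ size s) + 2 ^ size s)%N.
Proof.
move=> /andP[r0 r1]; rewrite /cylinder /restr /=.
elim/last_ind: s => [|s b IH].
  rewrite expr0 mulr1 (_ : Num.truncn r = 0%N) //.
  by apply/eqP; rewrite truncn_eq // r0 r1.
rewrite size_rcons mkseqS string_index_rcons expnS.
have := @truncn_odd_half R (r * 2 ^+ size s).
rewrite -mulrA -exprSr => -> //; last by rewrite mulr_ge0 // exprn_ge0.
rewrite /binary_digits; set o := odd _; split.
  by move=> /rcons_inj[/IH]; case: o => e <-; lia.
move=> e; have [<- e'] : o = b /\
   ((string_index s).+1 = Num.truncn (r * 2 ^+ size s) + 2 ^ size s)%N.
  by move: e; case: o b => [] [] /=; lia.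
by rewrite (IH.2 e').
Qed.

Lemma cylinder_digitsE (R : realType) (s : seq bool) :
  let k := ((string_index s).+1 - 2 ^ size s)%N in
  @binary_digits R @^-1` cylinder s `&` `[0, 1[ =
  `[k%:R / 2 ^+ size s, k.+1%:R / 2 ^+ size s[%classic.
Proof.
move=> k; have /andP[k1 k2] := string_index_bounds s.
have p0 : 0 < 2 ^+ size s :> R by rewrite exprn_gt0.
apply/seteqP; split=> r /=; rewrite !in_itv /=.
  move=> [+ r01] => /(cylinder_digitsP _ r01) e.
  rewrite ler_pdivrMr // ltr_pdivlMr // -truncn_eq; last first.
    by rewrite mulr_ge0 ?(ltW p0) //; case/andP: r01.
  by apply/eqP; rewrite /k e addnK.
move=> /andP[le_r lt_r].
have r0 : 0 <= r by apply: le_trans le_r; rewrite divr_ge0 // ltW.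
have r1 : r < 1.
  apply: lt_le_trans lt_r _; rewrite ler_pdivrMr // mul1r -natrX ler_nat.
  by move: k2; rewrite /k expnS; lia.
have r01 : 0 <= r < 1 by rewrite r0.
split=> //; apply/(cylinder_digitsP _ r01).
have -> : Num.truncn (r * 2 ^+ size s) = k.
  by apply: truncn_def; rewrite -ler_pdivrMr // -ltr_pdivlMr // le_r.
by rewrite /k subnK.
Qed.

Lemma measurable_binary_digits (R : realType) :
  measurable_fun (`[0, 1[ : set R) (@binary_digits R).
Proof.
apply: (@measurability _ _ _ cantor_measurableType _ _ (range cylinder)) => //.
move=> _ [_ [s _ <-] <-].
by rewrite setIC cylinder_digitsE; exact: measurable_itv.
Qed.

Section uniform_measure.
Context (R : realType).

(* The image of Lebesgue measure on [0, 1[ under the map taking a real to its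
   binary digits. *)
Definition uniform_measure (A : set cantor_measurableType) : \bar R :=
  lebesgue_measure ((`[0, 1[ : set R) `&` @binary_digits R @^-1` A).

Let mdigits (A : set cantor_measurableType) : measurable A ->
  measurable ((`[0, 1[ : set R) `&` @binary_digits R @^-1` A).
Proof. by apply: measurable_binary_digits; exact: measurable_itv. Qed.

Let uniform0 : uniform_measure set0 = 0%E.
Proof. by rewrite /uniform_measure preimage_set0 setI0 measure0. Qed.

Let uniform_ge0 A : (0 <= uniform_measure A)%E.
Proof. exact: measure_ge0. Qed.

Let uniform_sigma_additive : semi_sigma_additive uniform_measure.
Proof.
move=> F mF tF mUF; rewrite /uniform_measure preimage_bigcup setI_bigcupr.
apply: measure_semi_sigma_additive => [n||].
- exact: mdigits.
- apply/trivIsetP => i j _ _ ij.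
  move/trivIsetP : tF => /(_ _ _ I I ij) FiFj.
  rewrite setIACA setIid -preimage_setI (FiFj : F i `&` F j = set0).
  by rewrite preimage_set0 setI0.
- by rewrite -setI_bigcupr -preimage_bigcup; exact: mdigits.
Qed.

HB.instance Definition _ := isMeasure.Build _ _ _ uniform_measure
  uniform0 uniform_ge0 uniform_sigma_additive.

Lemma uniform_measure_cylinder (s : seq bool) :
  uniform_measure (cylinder s) = (2 ^- size s)%:E.
Proof.
rewrite /uniform_measure setIC cylinder_digitsE lebesgue_measure_itv /= lte_fin.
have p0 : 0 < 2 ^- size s :> R by rewrite invr_gt0 exprn_gt0.
by rewrite ltr_pM2r // ltr_nat ltnSn -EFinB -mulrBl -natrB // subSnn mul1r.
Qed.

Let uniform_setT : uniform_measure [set: _] = 1%E.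
Proof.
have <- : cylinder [::] = setT by apply/seteqP; split.
by rewrite uniform_measure_cylinder invr1.
Qed.

HB.instance Definition _ := Measure_isProbability.Build _ _ R
  uniform_measure uniform_setT.

End uniform_measure.

(* Codes for the partial recursive functions, indexed by arity. *)
Inductive recfun : nat -> Type :=
| RZero n : recfun n
| RSucc : recfun 1
| RProj n (i : 'I_n) : recfun n
| RComp m n (f : recfun m) (g : 'I_m -> recfun n) : recfun n
| RRec n (f : recfun n) (g : recfun n.+2) : recfun n.+1
| RMin n (f : recfun n.+1) : recfun n.

(* [rec_eval f v r] means that f is defined at v, with value r. In the clause
   of RRec, u i is the value of the recursion after i steps. *)
Fixpoint rec_eval n (f : recfun n) : n.-tuple nat -> nat -> Prop :=
  match f in recfun n return n.-tuple nat -> nat -> Prop with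
  | RZero _ => fun _ r => r = 0%N
  | RSucc => fun v r => r = (thead v).+1
  | RProj _ i => fun v r => r = tnth v i
  | RComp m _ f g => fun v r => exists w : m.-tuple nat,
      (forall i, rec_eval (g i) v (tnth w i)) /\ rec_eval f w r
  | RRec n f g => fun v r => exists u : nat -> nat,
      [/\ rec_eval f [tuple of behead v] (u 0%N),
          forall i, (i < thead v)%N ->
            rec_eval g [tuple of i :: u i :: behead v] (u i.+1) &
          r = u (thead v)]
  | RMin _ f => fun v r => rec_eval f [tuple of r :: v] 0%N /\
      forall i, (i < r)%N -> exists k, rec_eval f [tuple of i :: v] k.+1
  end.

Definition uniformly_ce (W : nat -> set (seq bool)) : Prop :=
  exists f : recfun 2, forall n s,
    W n s <-> exists r, rec_eval f [tuple n; string_index s] r.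

Definition martin_lof_test (R : realType) (W : nat -> set (seq bool)) : Prop :=
  uniformly_ce W /\
  forall n, (uniform_measure R (open_of (W n)) <= (2 ^- n)%:E)%E.

Definition martin_lof_random (R : realType) (x : cantor_space) : Prop :=
  forall W, martin_lof_test R W -> ~ (\bigcap_n open_of (W n)) x.

(* x n is the value at the string of index n.+1; the value at [::] is unused. *)
Definition representing_fun (x : cantor_space) (s : seq bool) : bool :=
  x (string_index s).-1.

Definition online_fun (x : cantor_space) : cantor_space -> cantor_space :=
  fun y n => representing_fun x (restr y n.+1).

Definition random_online_fun (R : realType)
    (F : cantor_space -> cantor_space) : Prop :=
  exists2 x, martin_lof_random R x & F = online_fun x.

(* Main.v *)
(* For a uniformly random code, the strings y for which F_x labels every
   nonempty prefix of y by 0 form a critical Galton-Watson tree (two children,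
   each kept with probability 1/2). Its survival probability p_d to depth d
   satisfies p_(d+1) = p_d - p_d^2 / 4, so p_d <= 4 / (d + 4). Hence "the tree
   survives to depth 2^(n+2)" is a Martin-Loef test, and a random F_x omits the
   zero sequence. The probability of survival is bounded by revealing x bit by
   bit: the conditional survival probability is a martingale because the
   extinction probability is affine in the killing probability of each node. *)
Require Import Defs.
From mathcomp Require Import all_boot all_order all_algebra zify ring lra.
From mathcomp Require Import all_classical all_reals all_analysis.
Import Order.TTheory GRing.Theory Num.Theory.

Local Open Scope classical_set_scope.

(** * Recursive functions on lists of arguments *)

(** Lists instead of tuples let function bodies use [nth 0] without arity bookkeeping; only lists of
    length [n] count. *)
Definition computable (n : nat) (F : seq nat -> nat) : Prop :=
  exists e : recfun n, forall (v : n.-tuple nat) r, rec_eval e v r <-> r = F v.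

Lemma eq_computable n F G : (forall v, F v = G v) ->
  computable n F -> computable n G.
Proof. by move=> FG [e He]; exists e => v r; rewrite -FG. Qed.

Lemma computable_nth n i : computable n (nth 0 ^~ i).
Proof.
have [lt_in|le_ni] := ltnP i n.
  by exists (RProj (Ordinal lt_in)) => v r /=; rewrite (tnth_nth 0).
by exists (RZero n) => v r /=; rewrite nth_default // size_tuple.
Qed.

Lemma computable_comp m n F (G : nat -> seq nat -> nat) :
    computable m F -> (forall i, i < m -> computable n (G i)) ->
  computable n (fun v => F (mkseq (G ^~ v) m)).
Proof.
move=> [f Hf] /= HG.
have [i|g Hg] := @choice 'I_m (recfun n) (fun i e =>
  forall (v : n.-tuple nat) r, rec_eval e v r <-> r = G i v); first exact: HG.
exists (RComp f g) => v r /=; split.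
  move=> [w [Hw /Hf ->]]; congr F.
  apply: (@eq_from_nth _ 0); rewrite size_tuple ?size_mkseq // => i lt_im.
  by rewrite nth_mkseq //; have /Hg <- := Hw (Ordinal lt_im); rewrite (tnth_nth 0).
move=> ->; exists [tuple of mkseq (G ^~ v) m]; split; last exact/Hf.
by move=> i; apply/Hg; rewrite (tnth_nth 0) /= nth_mkseq.
Qed.

Lemma computableS n A : computable n A -> computable n (fun v => (A v).+1).
Proof.
move=> HA; apply: (@computable_comp 1 n (fun v => (head 0 v).+1) (fun=> A)) => //.
by exists RSucc => v r; case/tupleP: v.
Qed.

Lemma computable_const n c : computable n (fun=> c).
Proof. by elim: c => [|c /computableS//]; exists (RZero n). Qed.

Lemma computable_rec n A F G :
    computable n A -> computable n F -> computable n.+2 G ->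
  computable n (fun v => nat_rect _ (F v) (fun i x => G (i :: x :: v)) (A v)).
Proof.
move=> HA [f Hf] [g Hg].
(* [RRec] recurses on its first argument, so the bound becomes the head of the list and [A v] is
   substituted for it afterwards. *)
pose H v := nat_rect (fun=> nat) (F (behead v))
  (fun i x => G (i :: x :: behead v)) (head 0 v).
have HH : computable n.+1 H.
  exists (RRec f g) => v r; case/tupleP: v => a v; rewrite /H /= theadE; split.
    move=> [u [/Hf u0 uS ->]] {r}.
    have {}uS i : i < a -> u i.+1 = G (i :: u i :: v) by move=> /uS /Hg.
    elim: a {H u0} (u0 : u 0 = F v) uS => //= a IH u0 uS.
    by rewrite uS // IH // => i lt_ia; rewrite uS // ltnS ltnW.
  move=> ->; exists (nat_rect (fun=> nat) (F v) (fun i x => G (i :: x :: v))).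
  by split=> // [|i _]; [exact/Hf | exact/Hg].
have HG i : i < n.+1 -> computable n (fun v => nth 0 (A v :: v) i).
  by case: i => [|i] _; [exact: HA | exact: computable_nth].
have [e He] := computable_comp n.+1 n H _ HH HG.
exists e => v r; rewrite He.
have -> // : mkseq [eta nth 0 (A v :: v)] n.+1 = A v :: v.
by rewrite -{2}(mkseq_nth 0 (A v :: v)) /= size_tuple.
Qed.

Lemma computableD n A B : computable n A -> computable n B ->
  computable n (fun v => A v + B v).
Proof.
move=> HA HB.
apply: eq_computable (computable_rec n B A (fun w => (nth 0 w 1).+1) HB HA _).
  by move=> v; elim: (B v) => [|b IH] /=; rewrite ?addn0 // IH addnS.
exact/computableS/computable_nth.
Qed.

Lemma computable_pred n A : computable n A -> computable n (fun v => (A v).-1).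
Proof.
move=> HA; apply: eq_computable (computable_rec n A (fun=> 0) (nth 0 ^~ 0) HA _ _).
- by move=> v; case: (A v).
- exact: computable_const.
- exact: computable_nth.
Qed.

Lemma computable_odd n A : computable n A -> computable n (fun v => odd (A v)).
Proof.
(* The inner recursion is negation on 0 and 1. *)
move=> HA; apply: eq_computable (computable_rec n A (fun=> 0)
  (fun w => nat_rect (fun=> nat) 1 (fun _ _ => 0) (nth 0 w 1)) HA _ _).
- by move=> v; elim: (A v) => //= a ->; case: odd.
- exact: computable_const.
- exact: (computable_rec _ _ _ (fun=> 0)) (computable_nth _ _)
    (computable_const _ _) (computable_const _ _).
Qed.

Lemma computable_half n A : computable n A -> computable n (fun v => (A v)./2).
Proof.
move=> HA; apply: eq_computable (computable_rec n A (fun=> 0)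
  (fun w => nth 0 w 1 + odd (nth 0 w 0)) HA _ _).
- by move=> v; elim: (A v) => // a /= ->; rewrite uphalf_half addnC.
- exact: computable_const.
- by apply: computableD; [|apply: computable_odd]; exact: computable_nth.
Qed.

Lemma computableB n A B : computable n A -> computable n B ->
  computable n (fun v => A v - B v).
Proof.
move=> HA HB.
apply: eq_computable (computable_rec n B A (fun w => (nth 0 w 1).-1) HB HA _).
  by move=> v; elim: (B v) => [|b IH] /=; rewrite ?subn0 // IH subnS.
exact/computable_pred/computable_nth.
Qed.

Lemma computable_exp2 n A : computable n A -> computable n (fun v => 2 ^ A v).
Proof.
move=> HA; apply: eq_computable (computable_rec n A (fun=> 1)
  (fun w => nth 0 w 1 + nth 0 w 1) HA _ _).
- by move=> v; elim: (A v) => // a /= ->; rewrite expnS mul2n addnn.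
- exact: computable_const.
- by apply: computableD; exact: computable_nth.
Qed.

Lemma computable_iter_half n A B : computable n A -> computable n B ->
  computable n (fun v => iter (B v) half (A v)).
Proof.
move=> HA HB.
apply: eq_computable (computable_rec n B A (fun w => (nth 0 w 1)./2) HB HA _).
  by move=> v; elim: (B v) => //= b ->.
exact/computable_half/computable_nth.
Qed.

(** This distance vanishes exactly when its arguments agree, so equality tests become zeros of
    computable functions. *)
Lemma computable_dist n A B : computable n A -> computable n B ->
  computable n (fun v => (A v - B v) + (B v - A v)).
Proof. by move=> HA HB; apply: computableD; exact: computableB. Qed.

(** Since [F] is total, unbounded search for a zero halts exactly when one exists. *)
Lemma computable_domain n F : computable n.+1 F ->
  exists e : recfun n, forall v : n.-tuple nat,
    (exists r, F (r :: v) = 0) <-> exists r, rec_eval e v r.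
Proof.
move=> [e He]; exists (RMin e) => v; split=> [ex_r|[r [/He r0 _]]]; last by exists r.
have ex_b : exists r, F (r :: v) == 0 by have [r /eqP] := ex_r; exists r.
exists (ex_minn ex_b) => /=; case: ex_minnP => r /eqP r0 min_r.
split=> [|i lt_ir]; first exact/He.
exists (F (i :: v)).-1; apply/He; rewrite prednK ?lt0n //.
by apply: contraTN lt_ir => /min_r; rewrite -leqNgt.
Qed.

(** * The test *)

Definition zero_path (f : seq bool -> bool) (y : seq bool) : Prop :=
  forall i, i < size y -> ~~ f (take i.+1 y).

(** Here [s] stands for an initial segment of a code; the test below only consults bits inside [s],
    never the default. *)
Definition label (s : seq bool) : seq bool -> bool :=
  representing_fun (nth false s).

(* A string of length exactly [string_index y] carries the labels of all nonempty
   prefixes of [y]; this lets the test recover [y] from [s]. *)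
Definition zero_path_test (n : nat) : set (seq bool) :=
  [set s | exists y, [/\ size y = 2 ^ n.+2, size s = string_index y &
    zero_path (label s) y]].

Lemma string_index_eq0 s : (string_index s == 0) = nilp s.
Proof.
by case/lastP: s => // s b; rewrite string_index_rcons /nilp size_rcons; lia.
Qed.

Lemma string_index_take j y : string_index (take j y) <= string_index y.
Proof.
elim/last_ind: y => [//|y b IH]; have [le_j|lt_j] := leqP j (size y).
  rewrite -cats1 takel_cat // cats1; apply: leq_trans IH _.
  by rewrite string_index_rcons; lia.
by rewrite take_oversize // size_rcons.
Qed.

Lemma string_index_take_gt0 i y : i < size y -> 0 < string_index (take i.+1 y).
Proof. by move=> lt_iy; rewrite lt0n string_index_eq0 /nilp size_takel. Qed.

Lemma iter_half_string_index i s : i <= size s ->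
  iter i half (string_index s).+1 = (string_index (take (size s - i) s)).+1.
Proof.
elim: i s => [|i IH] s; first by rewrite subn0 take_size.
case/lastP: s => [//|s b]; rewrite size_rcons ltnS => le_is.
rewrite iterSr string_index_rcons subSS -cats1 takel_cat ?leq_subr // -IH //.
by congr iter; case: b; lia.
Qed.

(** One halving too many gives 0, which stays 0, so the value 1 occurs only once. This expresses a
    length by an equation. *)
Lemma iter_half_string_index_eq1 i s :
  iter i half (string_index s).+1 = 1 <-> i = size s.
Proof.
split=> [|->]; last by rewrite iter_half_string_index // subnn take0.
have [lt_is|lt_si|//] := ltngtP i (size s).
  rewrite iter_half_string_index 1?ltnW // => -[/eqP].
  by rewrite string_index_eq0 /nilp size_takel ?leq_subr //; lia.
rewrite -{1}(subnK lt_si) iterD iterS iter_half_string_index // subnn take0 /=.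
by have -> : iter (i - (size s).+1) half 0 = 0 by elim: (i - _) => //= m ->.
Qed.

(** Keeping only the first [j] letters makes letter [j], counted from 1, the lowest binary digit. *)
Lemma odd_iter_half_string_index j s : 0 < j <= size s ->
  odd (iter (size s - j) half (string_index s).+1) = nth false s j.-1.
Proof.
case: j => // j /= lt_js; rewrite iter_half_string_index ?leq_subr // subKn //.
rewrite (take_nth false) // string_index_rcons.
by rewrite /= oddD odd_double; case: nth.
Qed.

(** As [size s] is the index of [y], halving its successor gives one more than the index of a prefix
    of [y]; that index is the position, counted from 1, of the prefix's label in [s]. *)
Lemma label_iter_half s y i : size s = string_index y -> i < size y ->
  odd (iter ((size s).+1 - iter i half (size s).+1) half (string_index s).+1) =
  label s (take (size y - i) y).
Proof.
move=> sy lt_iy; rewrite {2}sy (iter_half_string_index i y) ?(ltnW lt_iy) // subSS.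
apply: odd_iter_half_string_index.
rewrite lt0n string_index_eq0 /nilp size_takel ?leq_subr // subn_eq0 -ltnNge lt_iy.
by rewrite sy string_index_take.
Qed.

Lemma nat_rect_sum_eq0 (F : nat -> bool) N :
  nat_rect (fun=> nat) 0 (fun i x => x + F i) N = 0 <->
  forall i, i < N -> ~~ F i.
Proof.
elim: N => [|N IH] /=; first by [].
split=> [/eqP|H].
  rewrite addn_eq0 eqb0 => /andP[/eqP/IH H FN] i.
  by rewrite ltnS leq_eqVlt => /predU1P[->//|/H].
have -> : nat_rect (fun=> nat) 0 (fun i x => x + F i) N = 0.
  by apply/IH => i lt_iN; apply: H; rewrite ltnS ltnW.
by rewrite (negPf (H N _)).
Qed.

(* In terms of [a = string_index s + 1], whose binary expansion is [1s], halving
   drops the last letter of [s]. So the first summand checks [r = size s], the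
   second that the string y of index [r] has length [2 ^ n.+2], and the last
   one reads in [s] the labels of y and of its prefixes. *)
Definition zero_path_check (r n k : nat) : nat :=
  let D a i := iter i half a in
  (D k.+1 r - 1 + (1 - D k.+1 r)) +
  (D r.+1 (2 ^ n.+2) - 1 + (1 - D r.+1 (2 ^ n.+2))) +
  nat_rect (fun=> nat) 0 (fun i x => x + odd (D k.+1 (r.+1 - D r.+1 i)))
    (2 ^ n.+2).

Lemma zero_path_checkP n s :
  zero_path_test n s <-> exists r, zero_path_check r n (string_index s) = 0.
Proof.
split=> [[y [yn sy py]]|[r /eqP]].
  exists (size s); rewrite /zero_path_check.
  rewrite (iter_half_string_index_eq1 _ s).2 //.
  rewrite {1 2}sy (iter_half_string_index_eq1 _ y).2 //.
  rewrite !subnn !add0n.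
  apply/(nat_rect_sum_eq0 (fun i => odd _)) => i; rewrite -yn => lt_iy.
  rewrite (label_iter_half s y) //.
  (* The check counts letters dropped from the end of [y], [zero_path] counts from the front. *)
  by have := py (size y - i).-1; rewrite prednK ?subn_gt0 //; apply; lia.
have [y <-] : exists y, string_index y = r.
  by have [g _ gK] := string_index_bij; exists (g r).
rewrite !addn_eq0 !subn_eq0 -!andbA => /and5P[r1 r2 N1 N2 /eqP].
have /iter_half_string_index_eq1 sy :
  iter (string_index y) half (string_index s).+1 = 1 by lia.
have /iter_half_string_index_eq1 yn :
  iter (2 ^ n.+2) half (string_index y).+1 = 1 by lia.
move=> /(nat_rect_sum_eq0 (fun i => odd _)) H; exists y; split=> // i lt_iy.
have := H (size y - i.+1); rewrite sy (label_iter_half s y) ?sy //; last by lia.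
by rewrite yn subKn //; apply; lia.
Qed.

Lemma uniformly_ce_zero_path_test : uniformly_ce zero_path_test.
Proof.
have [|e He] := computable_domain 2
    (fun v => zero_path_check (nth 0 v 0) (nth 0 v 1) (nth 0 v 2)).
  have nthS m i : computable m (fun v => (nth 0 v i).+1).
    by apply: computableS; exact: computable_nth.
  have N m i : computable m (fun v => 2 ^ (nth 0 v i).+2).
    by apply: computable_exp2; exact: computableS.
  apply: computableD; first apply: computableD.
  - by apply: computable_dist (computable_const _ 1);
      apply: computable_iter_half => //; exact: computable_nth.
  - by apply: computable_dist (computable_const _ 1);
      exact: computable_iter_half.
  (* Two entries precede the arguments inside the recursion: [r] is at position 2 and the index of
     [s] at 4. *)
  - apply: eq_computable (computable_rec 3 _ (fun=> 0) (fun w => nth 0 w 1 +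
      odd (iter ((nth 0 w 2).+1 - iter (nth 0 w 0) half (nth 0 w 2).+1) half
                (nth 0 w 4).+1)) (N 3 1) (computable_const _ _) _) => //.
    apply: computableD; first exact: computable_nth.
    apply: computable_odd; apply: computable_iter_half => //.
    apply: computableB => //; apply: computable_iter_half => //.
    exact: computable_nth.
exists e => n s; rewrite zero_path_checkP.
exact: (He [tuple n; string_index s]).
Qed.

(** * Extinction probabilities *)

Section extinction.
Context {R : realFieldType}.
Local Open Scope ring_scope.
Implicit Types (w : seq bool -> R) (s t : seq bool).

(* Probability that no path of length [d] below [s] avoids all killed nodes, when
   each node [u] is killed independently with probability [w u]. *)
Fixpoint extinction w d s : R :=
  if d is d'.+1 then
    let branch b :=
      w (rcons s b) + (1 - w (rcons s b)) * extinction w d' (rcons s b) in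
    branch false * branch true
  else 0.

Lemma prefix_rcons_disjoint s t b :
  prefix (rcons s b) t -> ~~ prefix (rcons s (~~ b)) t.
Proof.
move=> /prefixP[u ->]; rewrite -!cats1 -catA prefix_catr // eqxx /=.
by case: b.
Qed.

(** The recursion consults [w] only at proper extensions of [s], and [t] is not one. *)
Lemma extinction_local w w' t d s :
    (forall u, u != t -> w u = w' u) -> (forall b, ~~ prefix (rcons s b) t) ->
  extinction w d s = extinction w' d s.
Proof.
move=> ww'; elim: d s => //= d IH s Hs.
have IHb b : extinction w d (rcons s b) = extinction w' d (rcons s b).
  by apply: IH => c; apply: contra (Hs b); apply: prefix_trans; exact: prefix_rcons.
rewrite !IHb !ww' //.
  by apply: contraNneq (Hs true) => ->; exact: prefix_refl.
by apply: contraNneq (Hs false) => ->; exact: prefix_refl.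
Qed.

(** At most one child of [s] is a prefix of [t], so at most one factor of the product depends on
    [w t], and it does so affinely. *)
Lemma extinction_affine w w0 w1 t d s :
    (forall u, u != t -> w0 u = w u) -> (forall u, u != t -> w1 u = w u) ->
    w t = (w0 t + w1 t) / 2 ->
  extinction w d s = (extinction w0 d s + extinction w1 d s) / 2.
Proof.
move=> ww0 ww1 wt; elim: d s => [|d IH] s; first by rewrite /= addr0 mul0r.
pose br v b := v (rcons s b) + (1 - v (rcons s b)) * extinction v d (rcons s b).
have br_off v b : (forall u, u != t -> v u = w u) ->
    ~~ prefix (rcons s b) t -> br v b = br w b.
  move=> vw Nst; rewrite /br (extinction_local _ _ _ _ _ vw) ?vw //.
    by apply: contraNneq Nst => ->; exact: prefix_refl.
  by move=> c; apply: contra Nst; apply: prefix_trans; exact: prefix_rcons.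
have br_mid b : br w b = (br w0 b + br w1 b) / 2.
  rewrite /br; have [e|ne] := eqVneq (rcons s b) t.
    have Nt c : ~~ prefix (rcons t c) t.
      by apply: contraTN (ltnSn (size t)) => /size_prefix; rewrite size_rcons -leqNgt.
    rewrite e (extinction_local _ _ _ d t ww0 Nt) (extinction_local _ _ _ d t ww1 Nt).
    by rewrite wt; lra.
  by rewrite ww0 // ww1 // IH; lra.
rewrite /= -/(br w false) -/(br w true) -/(br w0 false) -/(br w0 true)
  -/(br w1 false) -/(br w1 true).
have [pf|npf] := boolP (prefix (rcons s false) t).
  have npt := prefix_rcons_disjoint _ _ _ pf.
  by rewrite (br_off _ _ ww0 npt) (br_off _ _ ww1 npt) br_mid; lra.
by rewrite (br_off _ _ ww0 npf) (br_off _ _ ww1 npf) (br_mid true); lra.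
Qed.

Lemma extinction_itv w d s : (forall u, 0 <= w u <= 1) ->
  0 <= extinction w d s <= 1.
Proof.
move=> w01; elim: d s => [|d IH] s /=; first by rewrite lexx ler01.
have br01 b : 0 <= w (rcons s b) +
    (1 - w (rcons s b)) * extinction w d (rcons s b) <= 1.
  by have := w01 (rcons s b); have := IH (rcons s b); nra.
have /andP[f0 f1] := br01 false; have /andP[t0 t1] := br01 true.
by rewrite mulr_ge0 // mulr_ile1.
Qed.

(** At each level the branch factor along [y] vanishes, and with it the product. *)
Lemma extinction_zero_path w y s :
    (forall i, (i < size y)%N -> w (s ++ take i.+1 y) = 0) ->
  extinction w (size y) s = 0.
Proof.
elim: y s => //= b y IH s wy.
have e : extinction w (size y) (rcons s b) = 0.
  by apply: IH => i lt_iy; rewrite cat_rcons (wy i.+1).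
have w0 : w (rcons s b) = 0 by rewrite -(wy 0%N) // take0 cats1.
by case: b e w0 {wy} => -> ->; rewrite mulr0 addr0 ?mul0r ?mulr0.
Qed.

Lemma survival_le w d s : (forall u, w u = 2^-1) ->
  1 - extinction w d s <= 4 / d.+4%:R.
Proof.
move=> w2; elim: d s => [|d IH] s; first by rewrite /= subr0 divff.
rewrite /= !w2.
have p01 b : 0 <= extinction w d (rcons s b) <= 1.
  by apply: extinction_itv => u; rewrite w2; lra.
have := IH (rcons s false); have := IH (rcons s true).
have /andP[] := p01 false; have /andP[] := p01 true.
move: (extinction _ _ _) (extinction _ _ _) => a b b0 b1 a0 a1.
set q : R := 4 / d.+4%:R => qb qa.
have d0 : 0 < d.+4%:R :> R by rewrite ltr0n.
have q1 : q <= 1 by rewrite ler_pdivrMr // mul1r ler_nat.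
(* With [m = d + 4] this amounts to [(m - 1) * (m + 1) <= m ^ 2]. *)
have : q - q ^+ 2 / 4 <= 4 / d.+1.+4%:R.
  rewrite ler_pdivlMr ?ltr0n // -(natr1 d.+4) /q.
  have -> : (4 / d.+4%:R - (4 / d.+4%:R) ^+ 2 / 4) * (d.+4%:R + 1)
     = 4 - 4 / d.+4%:R ^+ 2 :> R by field; lra.
  by rewrite gerBl divr_ge0 // exprn_ge0 // ltW.
suff : 1 - (2^-1 + (1 - 2^-1) * a) * (2^-1 + (1 - 2^-1) * b) <= q - q ^+ 2 / 4.
  exact: le_trans.
(* Both factors are at least [1 - q / 2], whose square is [1 - (q - q ^+ 2 / 4)]. *)
by nra.
Qed.

End extinction.

(** * Measure of the test *)

Lemma measurable_cylinder s : measurable (cylinder s : set cantor_measurableType).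
Proof. by apply: sub_gen_smallest; exists s. Qed.

Lemma measurable_open_of W : measurable (open_of W : set cantor_measurableType).
Proof.
rewrite /open_of bigcup_mkcond; apply: countable_bigcupT_measurable => // s.
by case: ifP => _ //; exact: measurable_cylinder.
Qed.

Lemma cylinder_split s :
  cylinder s `<=` cylinder (rcons s false) `|` cylinder (rcons s true).
Proof.
move=> x; rewrite /cylinder /= /restr !size_rcons mkseqS => ->.
by case: (x (size s)); [right|left].
Qed.

Section maximal_inequality.
Context {R : realType}.
Local Open Scope ring_scope.
Local Notation mu := (uniform_measure R).

(** Markov's inequality for a martingale at the fixed time [L]: the bound is localized to cylinders
    and pulled back from length [L] to the root by averaging. *)
Lemma martingale_bound (V : seq bool -> R) (E : set cantor_measurableType) L :
    measurable E -> (forall s, 0 <= V s) ->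
    (forall s, V s = (V (rcons s false) + V (rcons s true)) / 2) ->
    (forall s, size s = L -> E `&` cylinder s !=set0 -> 1 <= V s) ->
  (mu E <= (V [::])%:E)%E.
Proof.
move=> mE V0 V_fair V1.
have mEc s : measurable (E `&` cylinder s).
  by apply: measurableI => //; exact: measurable_cylinder.
suff H m s : (size s + m)%N = L ->
    (mu (E `&` cylinder s) <= (2 ^- size s * V s)%:E)%E.
  have -> : E = E `&` cylinder [::].
    by rewrite (_ : cylinder [::] = setT) ?setIT //; apply/seteqP; split.
  by have := H L [::] erefl; rewrite invr1 mul1r.
elim: m s => [|m IH] s sL.
  have [->|/set0P Es] := eqVneq (E `&` cylinder s) set0.
    by rewrite measure0 lee_fin mulr_ge0 // invr_ge0 exprn_ge0.
  apply: (@le_trans _ _ (mu (cylinder s))).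
    by apply: le_measure; rewrite ?inE //; exact: measurable_cylinder.
  rewrite uniform_measure_cylinder lee_fin ler_peMr ?invr_ge0 ?exprn_ge0 //.
  by apply: V1 => //; rewrite -sL addn0.
apply: (@le_trans _ _ (mu ((E `&` cylinder (rcons s false)) `|`
                           (E `&` cylinder (rcons s true))))).
  apply: le_measure; rewrite ?inE //; first exact: measurableU.
  by rewrite -setIUr; apply: setIS; exact: cylinder_split.
apply: le_trans (measureU2 _ _ _) _ => //.
have := leeD (IH (rcons s false) _) (IH (rcons s true) _).
rewrite !size_rcons addSn -addnS => /(_ sL sL) /le_trans; apply.
by rewrite -EFinD lee_fin (V_fair s) exprS invfM; lra.
Qed.

End maximal_inequality.

Lemma label_restr x k u : 0 < string_index u <= k ->
  label (restr x k) u = representing_fun x u.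
Proof.
by move=> u_k; rewrite /label /representing_fun nth_mkseq //; lia.
Qed.

Section uniform_measure_bound.
Context {R : realType}.
Local Open Scope ring_scope.

(* The killing probability of each node given the initial bits s of the code:
   node u carries bit (string_index u).-1, and the root carries none. *)
Definition kill_prob (s u : seq bool) : R :=
  nth 2^-1 (2^-1 :: [seq (b : nat)%:R | b : bool <- s]) (string_index u).

Lemma kill_prob_itv s u : 0 <= kill_prob s u <= 1.
Proof.
rewrite /kill_prob; case: string_index => [|k] /=; first by lra.
have [lt_ks|le_sk] := ltnP k (size s).
  by rewrite (nth_map false) //; case: nth; rewrite ?lexx ?ler01.
by rewrite nth_default ?size_map //; lra.
Qed.

Lemma kill_prob_rcons s b u : string_index u != (size s).+1 ->
  kill_prob (rcons s b) u = kill_prob s u.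
Proof.
rewrite /kill_prob; case: string_index => [//|k] /=; rewrite eqSS => ne_k.
rewrite map_rcons nth_rcons size_map (negPf ne_k).
by case: ltnP => // le_sk; rewrite nth_default // size_map.
Qed.

(** The next bit settles the node of index [size s + 1]: its killing probability 1/2 becomes 0 or 1,
    with mean 1/2, and extinction is affine in it. *)
Lemma survival_fair d s :
  let V r := 1 - extinction (kill_prob r) d [::] in
  V s = (V (rcons s false) + V (rcons s true)) / 2.
Proof.
move=> V; have [t tE] : exists t, string_index t = (size s).+1.
  by have [g _ gK] := string_index_bij; exists (g (size s).+1).
have off b u : u != t -> kill_prob (rcons s b) u = kill_prob s u.
  move=> ne_ut; apply: kill_prob_rcons; apply: contra ne_ut.
  by rewrite -tE => /eqP/(bij_inj string_index_bij)->.
rewrite /V (extinction_affine _ _ _ t d [::] (off false) (off true)); first by lra.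
rewrite /kill_prob tE /= !map_rcons !nth_rcons !size_map ltnn eqxx.
by rewrite nth_default ?size_map //= add0r mul1r.
Qed.

Lemma uniform_measure_zero_path_test n :
  (uniform_measure R (open_of (zero_path_test n)) <= (2 ^- n)%:E)%E.
Proof.
pose N := (2 ^ n.+2)%N.
apply: (@le_trans _ _ (1 - extinction (kill_prob [::]) N [::])%:E); last first.
  rewrite lee_fin; apply: le_trans (survival_le _ _ _ _) _.
    by move=> u; rewrite /kill_prob; case: string_index => [|[|k]].
  (* Here [4 / (N + 4) <= 2 ^- n] since [N] is four times [2 ^ n]. *)
  rewrite ler_pdivrMr ?ltr0n // mulrC ler_pdivlMr ?exprn_gt0 //.
  by rewrite -natrX -natrM ler_nat /N !expnS; lia.
(* Nodes of depth at most [N] have index below [2 ^ N.+1], so a code prefix of that length reveals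
   all their labels. *)
apply: (martingale_bound (fun s => 1 - extinction (kill_prob s) N [::]) _ (2 ^ N.+1)).
- exact: measurable_open_of.
- by move=> s; have /andP[_] := extinction_itv _ N [::] (kill_prob_itv s); rewrite subr_ge0.
- by move=> s; exact: survival_fair.
move=> s sL [x [[r [y [yN ry py]] xr] xs]].
(* Both [r] and [s] are initial segments of [x], so the zero labels that [r] gives along [y] are
   also revealed by [s], and survival is certain. *)
rewrite -[N]yN (extinction_zero_path _ y [::]) ?subr0 // => i lt_iy.
rewrite cat0s /kill_prob.
have u0 := string_index_take_gt0 _ _ lt_iy.
have uy := string_index_take i.+1 y.
have := py i lt_iy; rewrite -xr label_restr ?u0 ?ry // /representing_fun.
move: u0 uy; case: string_index => //= k _ lt_ky.
have lt_ks : (k < size s)%N.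
  have /andP[_] := string_index_bounds y; rewrite sL -[N]yN => lt_y; lia.
rewrite (nth_map false) //.
by rewrite -xs /restr nth_mkseq // => /negPf->.
Qed.

End uniform_measure_bound.

Theorem corollary5p2 (R : realType) (F : cantor_space -> cantor_space)
    (F_random : random_online_fun R F) :
  range F <> [set: cantor_space].
Proof.
move: F_random => [x x_random ->] onto.
have [y _ Fy] : range (online_fun x) (fun=> false) by rewrite onto.
apply: (x_random zero_path_test).
  by split; [exact: uniformly_ce_zero_path_test|exact: uniform_measure_zero_path_test].
move=> n _; pose y' := restr y (2 ^ n.+2).
(* This prefix of [x] ends exactly at the label of [y'] itself. *)
exists (restr x (string_index y')); last by rewrite /cylinder /= /restr size_mkseq.
exists y'; rewrite !size_mkseq; split=> // i lt_i.
rewrite label_restr ?string_index_take ?string_index_take_gt0 //.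
have -> : take i.+1 y' = restr y i.+1.
  by move: lt_i; rewrite size_mkseq => lt_i; rewrite -map_take take_iota (minn_idPl lt_i).
by have /(congr1 (@^~ i)) := Fy; rewrite /online_fun => ->.
Qed.
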